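(* Let $(G,p)$ be a framework on $n$ vertices with $p$ a generic configuration, where either (a) $p$ is in $\mathbb{R}^2$ and $G$ is a Laman graph plus one additional edge, or (b) $p$ is in $\mathbb{R}^3$ and $G$ is a maximal planar graph plus one additional edge. If $(G,p)$ is dimensionally rigid, then $(G,p)$ is universally rigid.
   Context: A framework $(G,p)$ consists of a graph $G=(V,E)$ and positions $p_i$ of its vertices. Generic: coordinates satisfy no nonzero polynomial with rational coefficients. A Laman graph satisfies $|E|=2|V|-3$ with every subgraph on $k\ge2$ vertices having at most $2k-3$ edges; a maximal planar graph is planar and no edge can be added keeping it planar. $(G,p)$, whose affine span has dimension $d$, is dimensionally rigid if every framework $(G,q)$ (in any Euclidean dimension) with $\|q_i-q_j\|=\|p_i-p_j\|$ for all $ij\in E$ has affine span of dimension at most $d$. $(G,p)$ is universally rigid if the centered Gram matrix of $p$ is the unique solution of $\{X\in\mathcal{S}^n_+:\ X_{ii}+X_{jj}-2X_{ij}=\|p_i-p_j\|^2\ \forall ij\in E,\ Xe=0\}$ ($e$ the all-ones vector), i.e., every such $(G,q)$ is congruent to $(G,p)$. *)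

(* Defs.v *)
From HB Require Import structures.
From mathcomp Require Import all_boot all_order all_algebra.
From mathcomp Require Import all_classical all_reals all_analysis.

Set Implicit Arguments.
Unset Strict Implicit.
Unset Printing Implicit Defensive.

Import Order.TTheory GRing.Theory Num.Theory.
Import numFieldNormedType.Exports.
Local Open Scope ring_scope.

Definition is_graph (n : nat) (E : {set {set 'I_n}}) : Prop :=
  forall e, e \in E -> #|e| = 2%N.

(* Laman graph: |E| = 2|V| - 3, and every subgraph on k >= 2 vertices has
   at most 2k - 3 edges (induced subgraphs suffice, as they maximise the
   edge count on a vertex set). *)
Definition laman (n : nat) (E : {set {set 'I_n}}) : Prop :=
  is_graph E /\ #|E| = (2 * n - 3)%N /\
  forall S : {set 'I_n}, (2 <= #|S|)%N ->
    (#|[set e in E | e \subset S]| <= 2 * #|S| - 3)%N.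

Definition planar (R : realType) (n : nat) (E : {set {set 'I_n}}) : Prop :=
  exists (pos : 'I_n -> R * R) (gam : {set 'I_n} -> R -> R * R),
    injective pos /\
    (forall e, e \in E ->
       {within `[0, 1], continuous (fun t : R => (gam e t).1)}%classic /\
       {within `[0, 1], continuous (fun t : R => (gam e t).2)}%classic /\
       {in `[0, 1]%classic &, injective (gam e)} /\
       (exists u v, e = [set u; v] /\ gam e 0 = pos u /\ gam e 1 = pos v) /\
       (forall t w, 0 < t < 1 -> gam e t <> pos w)) /\
    (forall e f, e \in E -> f \in E -> e != f ->
       forall t s, 0 < t < 1 -> 0 < s < 1 -> gam e t <> gam f s).

Definition maximal_planar (R : realType) (n : nat) (E : {set {set 'I_n}})
  : Prop :=
  is_graph E /\ planar R E /\
  forall u v : 'I_n, u != v -> [set u; v] \notin E ->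
    ~ planar R ([set u; v] |: E).

Definition plus_one_edge (n : nat) (P : {set {set 'I_n}} -> Prop)
  (E : {set {set 'I_n}}) : Prop :=
  exists (E' : {set {set 'I_n}}) (u v : 'I_n),
    P E' /\ u != v /\ [set u; v] \notin E' /\ E = [set u; v] |: E'.

Definition sqnorm (R : realType) (d : nat) (x : 'rV[R]_d) : R :=
  (x *m x^T) 0 0.

Definition conf_mx (R : realType) (n d : nat) (p : 'I_n -> 'rV[R]_d)
  : 'M[R]_(n, d) := \matrix_(i < n) p i.

Definition centered (R : realType) (n d : nat) (p : 'I_n -> 'rV[R]_d)
  : 'M[R]_(n, d) :=
  \matrix_(i < n) (p i - (n%:R)^-1 *: \sum_(j < n) p j).

(* Dimension of the affine span of p (rank of the centered configuration;
   0 for the empty configuration). *)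
Definition affdim (R : realType) (n d : nat) (p : 'I_n -> 'rV[R]_d) : nat :=
  \rank (centered p).

Definition cgram (R : realType) (n d : nat) (p : 'I_n -> 'rV[R]_d)
  : 'M[R]_n := centered p *m (centered p)^T.

(* A polynomial with rational coefficients in N variables, of degree < k in
   each variable, is given by its coefficient family indexed by the (distinct)
   monomials m : {ffun 'I_N -> 'I_k}, standing for \prod_i X_i ^ (m i).
   Every rational polynomial has this form for k large enough; it is the zero
   polynomial iff all its coefficients vanish. *)
Definition rpoly_eval (R : realType) (N k : nat)
  (c : {ffun 'I_N -> 'I_k} -> rat) (x : 'I_N -> R) : R :=
  \sum_(m : {ffun 'I_N -> 'I_k}) ratr (c m) * \prod_(i < N) x i ^+ m i.

Definition alg_indep (R : realType) (N : nat) (x : 'I_N -> R) : Prop :=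
  forall (k : nat) (c : {ffun 'I_N -> 'I_k} -> rat),
    (exists m, c m != 0) -> rpoly_eval c x != 0.

Definition generic (R : realType) (n d : nat) (p : 'I_n -> 'rV[R]_d) : Prop :=
  alg_indep (fun k => mxvec (conf_mx p) 0 k).

Definition psd (R : realType) (n : nat) (X : 'M[R]_n) : Prop :=
  X^T = X /\ forall u : 'rV[R]_n, 0 <= (u *m X *m u^T) 0 0.

Definition dim_rigid (R : realType) (n d : nat) (E : {set {set 'I_n}})
  (p : 'I_n -> 'rV[R]_d) : Prop :=
  forall (D : nat) (q : 'I_n -> 'rV[R]_D),
    (forall i j, [set i; j] \in E -> sqnorm (q i - q j) = sqnorm (p i - p j)) ->
    (affdim q <= affdim p)%N.

Definition univ_rigid (R : realType) (n d : nat) (E : {set {set 'I_n}})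
  (p : 'I_n -> 'rV[R]_d) : Prop :=
  forall X : 'M[R]_n,
    psd X ->
    (forall i j, [set i; j] \in E ->
       X i i + X j j - 2 * X i j = sqnorm (p i - p j)) ->
    X *m (const_mx 1 : 'cV[R]_n) = 0 ->
    X = cgram p.

(* Main.v *)
(** If X is another solution of the Gram system, averaging it with the Gram
    matrix of p and using dimensional rigidity shows X = P (1 + Q) P^T, where P
    is the centered configuration and the symmetric matrix Q vanishes, as a
    quadratic form, on all edge directions.  It remains to see that the edge
    directions lie on no conic at infinity.  In the plane, three pairwise
    nonparallel directions suffice.  In space, any seven distinct edges suffice:
    a second moment computation gives a cut with three cut and three uncut edges
    among them, and the 6 x 6 determinant attached to these is nonzero because
    it is so when the last coordinate is the indicator of a side of the cut.
    Finally a graph with at most six edges is planar, since it embeds in two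
    pages: an order of the vertices is chosen so that every edge meets one of
    two fixed vertices or joins consecutive vertices.  Hence a maximal planar
    graph plus an edge, being nonplanar, has at least seven edges. *)

Require Import Defs.
From HB Require Import structures.
From mathcomp Require Import all_boot all_order all_algebra.
From mathcomp Require Import all_classical all_reals all_analysis.
From mathcomp Require Import ring lra zify.

Set Implicit Arguments.
Unset Strict Implicit.
Unset Printing Implicit Defensive.

Import Order.TTheory GRing.Theory Num.Theory.
Import numFieldNormedType.Exports.
Local Open Scope ring_scope.

(** * Dimensional rigidity and conics at infinity *)

Lemma sqnormE (R : realType) (d : nat) (x : 'rV[R]_d) :
  sqnorm x = \sum_k x 0 k ^+ 2.
Proof.
by rewrite /sqnorm mxE; apply: eq_bigr => k _; rewrite mxE -expr2.
Qed.

Lemma sqnorm_eq0 (R : realType) (d : nat) (x : 'rV[R]_d) :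
  sqnorm x = 0 -> x = 0.
Proof.
rewrite sqnormE => /eqP; rewrite psumr_eq0 => [/allP x0|k _]; last exact: sqr_ge0.
apply/rowP => k; rewrite mxE; apply/eqP.
by rewrite -sqrf_eq0; have := x0 k (mem_index_enum k).
Qed.

Lemma sqnormZ (R : realType) (d : nat) (a : R) (x : 'rV[R]_d) :
  sqnorm (a *: x) = a ^+ 2 * sqnorm x.
Proof.
by rewrite !sqnormE mulr_sumr; apply: eq_bigr => k _; rewrite mxE exprMn.
Qed.

Lemma sqnorm_row_mx (R : realType) (d d' : nat) (x : 'rV[R]_d) (y : 'rV[R]_d') :
  sqnorm (row_mx x y) = sqnorm x + sqnorm y.
Proof. by rewrite {1}/sqnorm tr_row_mx mul_row_col mxE. Qed.

(** Cholesky factorisation by induction on the size: a positive corner entry is split off and its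
    Schur complement is again positive semidefinite, while a zero corner forces the rest of its row
    and column to vanish. *)
Lemma psd_gram (R : realType) (n : nat) (X : 'M[R]_n) :
  psd X -> exists Y : 'M[R]_n, X = Y *m Y^T.
Proof.
elim: n X => [|n IHn] X [Xsym Xpos].
  by exists 0; apply/matrixP => -[].
have [a [b [C defX]]] : exists a : R, exists b : 'cV[R]_n, exists C : 'M[R]_n,
    (X : 'M[R]_(1 + n)) = block_mx a%:M b^T b C.
  exists (X 0 0), (@dlsubmx _ 1 n 1 n X), (@drsubmx _ 1 n 1 n X).
  rewrite -[LHS](@submxK _ 1 n 1 n); congr block_mx.
    by apply/matrixP => i j; rewrite !ord1 !mxE /= mulr1n; congr (X _ _); apply/val_inj.
  by rewrite trmx_dlsub Xsym.
have Csym : C^T = C.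
  move: Xsym; rewrite defX (@tr_block_mx _ 1 n 1 n) => eqX.
  by have [_ _ _ ->] := @eq_block_mx _ 1 n 1 n _ _ _ _ _ _ _ _ eqX.
have quad (t : R) (v : 'rV[R]_n) :
    0 <= a * t ^+ 2 + t * (v *m b) 0 0 *+ 2 + (v *m C *m v^T) 0 0.
  have := Xpos (row_mx t%:M v : 'rV[R]_(1 + n)); rewrite defX.
  rewrite (@mul_row_block _ 1 1 n 1 n) (@tr_row_mx _ 1 1 n) (@mul_row_col _ 1 1 n).
  rewrite tr_scalar_mx !mulmxDl -!scalar_mxM !mul_scalar_mx !mul_mx_scalar.
  have e1 : b^T *m v^T = v *m b.
    by rewrite -trmx_mul; apply/matrixP => i j; rewrite !ord1 mxE.
  rewrite -scalemxAl e1 !mxE /= mulr1n.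
  congr (0 <= _); rewrite -!/(mxtrace _).
  rewrite expr2; ring.
have [a0|a_gt0|a_eq0] := ltgtP a 0.
- have := quad 1 0; rewrite !mul0mx !mxE; lra.
- pose s := Num.sqrt a.
  have ss : s * s = a by rewrite -expr2 sqr_sqrtr // ltW.
  have s0 : s != 0 by rewrite lt0r_neq0 // sqrtr_gt0.
  have [|Y defY] := IHn (C - a^-1 *: (b *m b^T)).
    split; first by rewrite linearB linearZ /= trmx_mul trmxK Csym.
    (* This value of [t] minimises the quadratic in [t]; the minimum is the Schur complement
       evaluated at [v]. *)
    move=> v; have := quad (- (a^-1 * (v *m b) 0 0)) v.
    rewrite mulmxBr mulmxBl [X in _ -> 0 <= X]mxE [X in _ -> 0 <= _ + X]mxE.
    rewrite -scalemxAr -scalemxAl [X in _ -> 0 <= _ - X]mxE mulmxA.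
    rewrite -(mulmxA (v *m b)) -trmx_mul [X in _ -> 0 <= _ - _ * X]mxE.
    rewrite big_ord1 [X in _ -> 0 <= _ - _ * (_ * X)]mxE.
    move: ((v *m b) 0 0) ((v *m C *m v^T) 0 0) => x y.
    have an0 : a != 0 by rewrite lt0r_neq0.
    suff -> : a * (- (a^-1 * x)) ^+ 2 + - (a^-1 * x) * x *+ 2 + y =
              y - a^-1 * (x * x) by [].
    by field.
  exists (block_mx s%:M 0 (s^-1 *: b) Y : 'M[R]_(1 + n)).
  rewrite defX (@tr_block_mx _ 1 n 1 n) (@mulmx_block _ 1 n 1 n 1 n).
  rewrite tr_scalar_mx !trmx0 !linearZ /= !mulmx0 !mul0mx !addr0 -scalar_mxM ss.
  rewrite mul_scalar_mx scalerA mulVf // scale1r mul_mx_scalar scalerA divff //.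
  by rewrite scale1r -scalemxAl scalerA -invfM ss -defY addrC subrK.
- have b0 : b = 0.
    apply/colP => i; rewrite mxE.
    pose v : 'rV[R]_n := delta_mx 0 i.
    have vb : (v *m b) 0 0 = b i 0 by rewrite -rowE mxE.
    have := fun t => quad t v; rewrite vb a_eq0.
    move: (_ 0 0) (b i 0) => c x H.
    have := H 0.
    have [//|x0] := eqVneq x 0.
    (* With zero corner the form is affine in [t]; here it equals [- 2 - c], whereas [H 0] gives
       [0 <= c]. *)
    have := H (- (1 + c) / x); rewrite mul0r add0r divfK //.
    by lra.
  have [|Y defY] := IHn C.
    split => // v; have := quad 0 v.
    by rewrite mul0r mul0rn expr0n /= mulr0 addr0 add0r.
  exists (block_mx 0 0 0 Y : 'M[R]_(1 + n)).
  rewrite defX (@tr_block_mx _ 1 n 1 n) (@mulmx_block _ 1 n 1 n 1 n).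
  by rewrite !trmx0 !mulmx0 !mul0mx !addr0 add0r -defY b0 trmx0 a_eq0 raddf0.
Qed.

Section DimensionalRigidity.
Variables (R : realType) (n : nat).

Lemma centered_sum0 d (Y : 'M[R]_(n, d)) :
  (const_mx 1 : 'rV[R]_n) *m Y = 0 -> centered (fun i => row i Y) = Y.
Proof.
move=> Y0; suff s0 : \sum_j row j Y = 0.
  by apply/row_matrixP => i; rewrite rowK s0 scaler0 subr0.
rewrite -[RHS]Y0; apply/rowP => k; rewrite summxE mxE.
by apply: eq_bigr => j _; rewrite !mxE mul1r.
Qed.

Lemma centered_row_mx d d' (p : 'I_n -> 'rV[R]_d) (q : 'I_n -> 'rV[R]_d') :
  centered (fun i => row_mx (p i) (q i)) = row_mx (centered p) (centered q).
Proof.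
apply/row_matrixP => i; rewrite row_row_mx !rowK.
have -> : \sum_j row_mx (p j) (q j) = row_mx (\sum_j p j) (\sum_j q j).
  by apply/rowP => k; rewrite summxE mxE; case: split_ordP => k' ->;
     rewrite summxE; apply: eq_bigr => j _; rewrite ?row_mxEl ?row_mxEr.
by rewrite scale_row_mx opp_row_mx add_row_mx.
Qed.

Lemma centered_scale d (a : R) (p : 'I_n -> 'rV[R]_d) :
  centered (fun i => a *: p i) = a *: centered p.
Proof.
apply/row_matrixP => i; rewrite linearZ /= !rowK -scaler_sumr.
by rewrite scalerBr !scalerA mulrC.
Qed.

Lemma centered_sub d (p : 'I_n -> 'rV[R]_d) i j :
  row i (centered p) - row j (centered p) = p i - p j.
Proof. by rewrite !rowK opprB addrA subrK. Qed.

(** The column space of [A] lies in that of the joined matrix; the rank bound makes them equal, so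
    the columns of [B] are combinations of those of [A]. *)
Lemma mxrank_row_mx_le m k1 k2 (A : 'M[R]_(m, k1)) (B : 'M[R]_(m, k2)) :
  (\rank (row_mx A B) <= \rank A)%N -> exists M, B = A *m M.
Proof.
rewrite -mxrank_tr tr_row_mx -(mxrank_tr A) => rk.
have AB : (A^T <= col_mx A^T B^T)%MS by rewrite -addsmxE addsmxSl.
have : (col_mx A^T B^T <= A^T)%MS by rewrite -(geq_leqif (mxrank_leqif_sup AB)).
rewrite col_mx_sub => /andP[_ /submxP[D defB]].
by exists D^T; rewrite -[B]trmxK defB trmx_mul trmxK.
Qed.

Lemma gram_edge d (Y : 'M[R]_(n, d)) (Q : 'M[R]_d) i j : Q^T = Q ->
  let G := Y *m Q *m Y^T in
  let w := row i Y - row j Y in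
  G i i + G j j - 2 * G i j = (w *m Q *m w^T) 0 0.
Proof.
move=> Qsym G w.
have GE a b : G a b = (row a Y *m Q *m (row b Y)^T) 0 0.
  by rewrite -row_mul tr_row -row_mul /G !mxE; apply: eq_bigr => k _; rewrite !mxE.
have Gsym : G j i = G i j.
  suff Gt : G^T = G by rewrite -{1}Gt mxE.
  by rewrite /G !trmx_mul trmxK Qsym mulmxA.
have BE (A B : 'M[R]_1) : (A - B) 0 0 = A 0 0 - B 0 0 by rewrite !mxE.
rewrite /w linearB /= mulmxBl mulmxBr !mulmxBl !BE -!GE Gsym.
ring.
Qed.

(* If X solves the Gram system, so does the average of X and cgram p, realised
   by a concatenated configuration; dimensional rigidity forces its rank not to
   exceed that of p, so the new coordinates are linear in the old ones. *)
Lemma univ_rigid_of_no_conic d (E : {set {set 'I_n}}) (p : 'I_n -> 'rV[R]_d) :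
  (forall Q : 'M[R]_d, Q^T = Q ->
     (forall i j, [set i; j] \in E ->
        ((p i - p j) *m Q *m (p i - p j)^T) 0 0 = 0) -> Q = 0) ->
  dim_rigid E p -> univ_rigid E p.
Proof.
move=> noconic rigid X Xpsd Xedge X1.
have [Y defX] := psd_gram Xpsd.
(* The squared norm of the sum of the rows of [Y] is an entry of [1 X 1^T], which vanishes; hence
   [Y] is already centered. *)
have Y1 : (const_mx 1 : 'rV[R]_n) *m Y = 0.
  apply: sqnorm_eq0; rewrite /sqnorm trmx_mul trmx_const mulmxA -(mulmxA _ Y).
  by rewrite -defX -mulmxA X1 mulmx0 mxE.
(* The weights satisfy [(3/5)^2 + (4/5)^2 = 1], so edge lengths are kept, and no square root is
   required. *)
pose q i := row_mx ((3 / 5) *: p i) ((4 / 5) *: row i Y).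
have eucl i j : sqnorm (row i Y - row j Y) = X i i + X j j - 2 * X i j.
  have := @gram_edge _ Y 1%:M i j (trmx1 _ _).
  by rewrite /= !mulmx1 -defX => ->.
have qedge i j : [set i; j] \in E -> sqnorm (q i - q j) = sqnorm (p i - p j).
  move=> ijE; rewrite /q opp_row_mx add_row_mx -!scalerBr.
  rewrite sqnorm_row_mx !sqnormZ eucl Xedge //; lra.
have := rigid _ _ qedge; rewrite /affdim /q centered_row_mx !centered_scale.
rewrite centered_sum0 // => rk.
have [|M defY] := @mxrank_row_mx_le _ _ _ ((3 / 5) *: centered p) ((4 / 5) *: Y).
  by rewrite (leq_trans rk) // mxrank_scale_nz //; lra.
have {}defY : Y = centered p *m ((3 / 4) *: M).
  rewrite -scalemxAr -[LHS]scale1r.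
  have -> : 1 = (5 / 4) * (4 / 5) :> R by lra.
  rewrite -scalerA defY -scalemxAl scalerA; congr (_ *: _); lra.
move: (_ *: M) => {}M in defY.
pose Q := M *m M^T - 1%:M.
have Qsym : Q^T = Q by rewrite /Q linearB /= trmx_mul trmxK trmx1.
have PQ : X - cgram p = centered p *m Q *m (centered p)^T.
  rewrite /Q mulmxBr mulmxBl mulmx1 -/(cgram p) defX {1 2}defY trmx_mul.
  by rewrite !mulmxA.
suff Q0 : Q = 0 by apply/eqP; rewrite -subr_eq0 PQ Q0 mulmx0 mul0mx.
apply: noconic => // i j ijE.
have := gram_edge (centered p) i j Qsym; rewrite /= centered_sub => <-.
rewrite -PQ.
have := @gram_edge _ (centered p) 1%:M i j (trmx1 _ _).
rewrite /= !mulmx1 centered_sub -/(cgram p) -/(sqnorm _) -(Xedge _ _ ijE).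
rewrite !mxE; lra.
Qed.

End DimensionalRigidity.

(** * Two-page drawings *)

Section BookEmbedding.
Variables (R : realType) (n : nat).
Implicit Types (E : {set {set 'I_n}}) (e : {set 'I_n}).

(** Only one of the two crossing orders; the other is obtained by exchanging the two intervals. *)
Definition interleaved (l h l' h' : nat) := [&& l < l', l' < h & h < h']%N.

Lemma nested_of_not_interleaved l h l' h' : (l < h')%N -> (l' < h)%N ->
  ~~ interleaved l h l' h' -> ~~ interleaved l' h' l h ->
  ((l <= l') && (h' <= h) || (l' <= l) && (h <= h'))%N.
Proof. rewrite /interleaved; lia. Qed.

Lemma ordered_ends (f : 'I_n -> nat) E : injective f -> is_graph E ->
  exists l h : {set 'I_n} -> nat, forall e, e \in E ->
    exists a b, [/\ e = [set a; b], l e = f a, h e = f b & (l e < h e)%N].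
Proof.
move=> f_inj gE.
pose P e (y : nat * nat) := e \in E ->
  exists a b, [/\ e = [set a; b], y.1 = f a, y.2 = f b & (y.1 < y.2)%N].
have /choice[g gP] : forall e, exists y, P e y.
  (* Sets that are not edges receive the dummy ends [(0, 0)], since choice ranges over all sets. *)
  move=> e; have [eE|] := boolP (e \in E); last by exists (0, 0)%N => /idPn.
  have /eqP/cards2P[a [b [ab ->]]] := gE _ eE.
  have [lt|lt|/f_inj eq_ab] := ltngtP (f a) (f b).
  - by exists (f a, f b) => _; exists a, b.
  - by exists (f b, f a) => _; exists b, a; rewrite finset.setUC.
  - by rewrite eq_ab eqxx in ab.
by exists (fun e => (g e).1), (fun e => (g e).2) => e /gP.
Qed.

(* A point with abscissa [x] on the parabola arc of an edge with ends [l] and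
   [h] has height [(x - l) * (h - x)], up to the sign given by the page. *)
Lemma nested_arcs_disjoint (l h l' h' x : R) : l <= l' -> h' <= h ->
  (l != l') || (h != h') ->
  l' < x < h' -> (x - l') * (h' - x) < (x - l) * (h - x).
Proof.
move=> ll hh neq /andP[lx xh].
have [lt|] := boolP (l < l'); first by nra.
rewrite -leNgt => le; have eq_l : l = l' by apply/eqP; rewrite eq_le ll le.
move: neq; rewrite eq_l eqxx /= => neq.
have : h' < h by rewrite lt_neqAle eq_sym neq.
nra.
Qed.

(** Vertices sit on a horizontal axis and edges are parabola arcs above or below it according to the
    page. Arcs on different pages are separated by the sign of the height; on one page, intervals
    that do not interleave are disjoint or nested, and nested arcs do not meet. *)
Lemma planar_of_two_page (f : 'I_n -> nat) (page : {set 'I_n} -> bool)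
    (l h : {set 'I_n} -> nat) E :
  injective f ->
  (forall e, e \in E ->
    exists a b, [/\ e = [set a; b], l e = f a, h e = f b & (l e < h e)%N]) ->
  {in E &, forall e e', page e = page e' ->
     ~~ interleaved (l e) (h e) (l e') (h e')} ->
  planar R E.
Proof.
move=> f_inj ends noX.
pose len e : R := (h e)%:R - (l e)%:R.
pose gam e (t : R) : R * R :=
  ((l e)%:R + t * len e, (-1) ^+ page e * (t * (1 - t) * len e ^+ 2)).
have len_gt0 e : e \in E -> 0 < len e.
  by move=> /ends[a [b [_ _ _ lt]]]; rewrite subr_gt0 ltr_nat.
have hgt_gt0 e t : e \in E -> 0 < t < 1 -> 0 < t * (1 - t) * len e ^+ 2.
  move=> /len_gt0 le0 /andP[t0 t1].
  by apply: mulr_gt0 (mulr_gt0 t0 _) (exprn_gt0 _ le0); rewrite subr_gt0.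
exists (fun i => ((f i)%:R, 0)), gam; split; [|split].
- by move=> i j [] /eqP; rewrite eqr_nat => /eqP /f_inj.
- move=> e eE; have [a [b [eab la hb lt]]] := ends e eE.
  split; [|split; [|split; [|split]]].
  + apply: continuous_subspaceT => t; rewrite /gam /=.
    by apply: cvgD; [exact: cvg_cst|apply: cvgM; [exact: cvg_id|exact: cvg_cst]].
  + apply: continuous_subspaceT => t; rewrite /gam /=.
    apply: cvgM; first exact: cvg_cst.
    apply: cvgM; last exact: cvg_cst.
    apply: cvgM; first exact: cvg_id.
    by apply: cvgB; [exact: cvg_cst|exact: cvg_id].
  + move=> t s _ _ [] /addrI /mulIf H _; apply: H.
    by rewrite lt0r_neq0 ?len_gt0.
  + exists a, b; split=> //; rewrite /gam /len -la -hb.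
    by split; congr pair; ring.
  + move=> t w t01 [] _ /eqP; rewrite mulf_eq0 signr_eq0 /=.
    by apply/negP; rewrite lt0r_neq0 ?hgt_gt0.
- move=> e1 e2 e1E e2E e12 t1 t2 t101 t201 [].
  set x := (X in X = _ -> _) => eqx; rewrite /gam => eqy.
  (* Both heights are nonzero with sign given by the page, so equal heights force equal pages. *)
  have eqp : page e1 = page e2.
    have := hgt_gt0 _ _ e1E t101; have := hgt_gt0 _ _ e2E t201.
    move: eqy; case: (page e1) (page e2) => -[] //=;
      rewrite ?expr0 ?expr1; lra.
  have {}eqy : (x - (l e1)%:R) * ((h e1)%:R - x) = (x - (l e2)%:R) * ((h e2)%:R - x).
    move: eqy; rewrite eqp => /(mulfI (negbT (signr_eq0 _ _))) eqy.
    transitivity (t1 * (1 - t1) * len e1 ^+ 2); first by rewrite /x /len; ring.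
    by rewrite eqy eqx /len; ring.
  have in_arc e t : e \in E -> 0 < t < 1 -> (l e)%:R < (l e)%:R + t * len e < (h e)%:R.
    move=> /len_gt0; rewrite /len; nra.
  have x1 : (l e1)%:R < x < (h e1)%:R by exact: in_arc.
  have x2 : (l e2)%:R < x < (h e2)%:R by rewrite eqx; exact: in_arc.
  have ov12 : (l e1 < h e2)%N by rewrite -(ltr_nat R); lra.
  have ov21 : (l e2 < h e1)%N by rewrite -(ltr_nat R); lra.
  have neq : (l e1 != l e2) || (h e1 != h e2).
    have [a [b [e1ab -> -> _]]] := ends e1 e1E.
    have [a' [b' [e2ab -> -> _]]] := ends e2 e2E.
    rewrite -negb_and; apply: contra e12 => /andP[/eqP/f_inj aa /eqP/f_inj bb].
    by rewrite e1ab e2ab aa bb.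
  have := noX _ _ e1E e2E eqp; have := noX _ _ e2E e1E (esym eqp).
  move=> nX21 nX12.
  have [/andP[ll hh]|/andP[ll hh]] := orP (nested_of_not_interleaved ov12 ov21 nX12 nX21).
  + have := @nested_arcs_disjoint (l e1)%:R (h e1)%:R (l e2)%:R (h e2)%:R x.
    by rewrite !ler_nat !eqr_nat eqy ltxx; move/(_ ll hh neq x2).
  + have := @nested_arcs_disjoint (l e2)%:R (h e2)%:R (l e1)%:R (h e1)%:R x.
    rewrite !ler_nat !eqr_nat eqy ltxx eq_sym (eq_sym (h e2)).
    by move/(_ ll hh neq x1).
Qed.

Definition consecutive (s : seq 'I_n) e :=
  exists a b, [/\ e = [set a; b], a \in s, b \in s & index b s = (index a s).+1].

(** Edges with a common end never interleave, and an edge joining neighbours on the axis interleaves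
    with nothing. So the star of [v] with the consecutive edges fits on one page, and the rest of
    the star of [w] on the other. *)
Lemma planar_of_two_stars E (v w : 'I_n) (s : seq 'I_n) :
  is_graph E -> uniq s ->
  (forall e, e \in E -> [\/ v \in e, w \in e | consecutive s e]) ->
  planar R E.
Proof.
move=> gE s_uniq cover.
(* The vertices of [s] come first, in order; the shift by [size s] keeps the others clear of
   them. *)
pose f (i : 'I_n) : nat := if i \in s then index i s else (size s + i)%N.
have f_inj : injective f.
  move=> i j; rewrite /f.
  have := index_mem i s; have := index_mem j s.
  have [js|js] := boolP (j \in s); have [is_|is_] := boolP (i \in s) => jj ij.
  - by move=> /(congr1 (nth i s)); rewrite !nth_index.
  - by move: jj => /[swap] <-; rewrite ltnNge leq_addr.
  - by move: ij => /[swap] ->; rewrite ltnNge leq_addr.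
  - by move=> /addnI /val_inj.
have [l [h ends]] := ordered_ends f_inj gE.
have share x : {in E &, forall e e', x \in e -> x \in e' ->
    ~~ interleaved (l e) (h e) (l e') (h e')}.
  move=> e e' /ends[a [b [-> -> -> _]]] /ends[a' [b' [-> -> -> _]]].
  by rewrite !inE /interleaved => /orP[]/eqP-> /orP[]/eqP->; lia.
have consec e : e \in E -> consecutive s e -> h e = (l e).+1.
  move=> /ends[a [b [-> -> ->]]] lt [a' [b' [eab a's b's idx]]].
  have fa' : f a' = index a' s by rewrite /f a's.
  have fb' : f b' = (index a' s).+1 by rewrite /f b's.
  have : a \in [set a'; b'] by rewrite -eab !inE eqxx.
  have : b \in [set a'; b'] by rewrite -eab !inE eqxx orbT.
  by rewrite !inE => /orP[]/eqP eb /orP[]/eqP ea; move: lt; rewrite eb ea; lia.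
apply: (@planar_of_two_page f (fun e => (v \notin e) && (w \in e)) l h) => //.
move=> e e' eE e'E.
case: (boolP (v \in e)) => ve; case: (boolP (v \in e')) => ve' /=.
- by move=> _; exact: share ve ve'.
- move=> /esym we'; case: (cover _ e'E); rewrite ?(negPf ve') ?we' //.
  move=> ce'; have := consec _ e'E ce'; rewrite /interleaved; lia.
- move=> we; case: (cover _ eE); rewrite ?(negPf ve) ?we //.
  move=> ce; have := consec _ eE ce; rewrite /interleaved; lia.
- case: (boolP (w \in e)) => we /esym we'; first exact: share we we'.
  case: (cover _ eE); rewrite ?(negPf ve) ?(negPf we) //.
  move=> ce; have := consec _ eE ce; rewrite /interleaved; lia.
Qed.

End BookEmbedding.

(** * Planarity of graphs with at most six edges *)

Definition edges_at n (E : {set {set 'I_n}}) (v : 'I_n) :=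
  [set e in E | v \in e].

(** The ends of the edges are listed pair by pair. The clause that [s] contains only ends of edges
    in [r] serves the induction: the ends of a new disjoint edge are then new to [s]. *)
Lemma linear_order_of_disjoint n (r : seq {set 'I_n}) :
  uniq r -> {in r, forall e : {set 'I_n}, #|e| = 2%N} ->
  {in r &, forall e e' : {set 'I_n}, e != e' -> [disjoint e & e']} ->
  exists s : seq 'I_n,
    [/\ uniq s, forall x, x \in s -> exists2 e, e \in r & x \in e
      & forall e, e \in r -> consecutive s e].
Proof.
elim: r => [|e r IHr] /=; first by exists [::].
move=> /andP[er r_uniq] card_r dis_r.
have [e1 r1|e1 e2 r1 r2|s [s_uniq s_sub s_consec]] := IHr r_uniq.
- by apply: card_r; rewrite inE r1 orbT.
- by apply: dis_r; rewrite inE ?r1 ?r2 orbT.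
have /eqP/cards2P[a [b [ab defe]]] := card_r e (mem_head e r).
have not_s x : x \in e -> x \notin s.
  move=> xe; apply/negP => /s_sub[e' e'r xe'].
  have /pred0P/(_ x) : [disjoint e & e'].
    apply: dis_r; rewrite ?inE ?eqxx ?e'r ?orbT //.
    by apply: contraNneq er => ->.
  by rewrite /= xe xe'.
have as_ : a \notin s by apply: not_s; rewrite defe !inE eqxx.
have bs : b \notin s by apply: not_s; rewrite defe !inE eqxx orbT.
exists [:: a, b & s]; split.
- by rewrite /= inE negb_or ab as_ bs.
- move=> x; rewrite !inE => /or3P[/eqP->|/eqP->|/s_sub[e' e'r xe']].
  + by exists e; rewrite ?mem_head // defe !inE eqxx.
  + by exists e; rewrite ?mem_head // defe !inE eqxx orbT.
  + by exists e'; rewrite // inE e'r orbT.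
- move=> e'; rewrite inE => /orP[/eqP->|/s_consec[a' [b' [-> a's b's idx]]]].
    exists a, b; rewrite !inE !eqxx orbT /= eqxx (negPf ab); split=> //.
    by rewrite eqxx.
  exists a', b'; split; rewrite ?inE ?a's ?b's ?orbT //=.
  have neq x y : x \in s -> y \notin s -> (y == x) = false.
    by move=> xs ys; apply: contraNF ys => /eqP->.
  by rewrite !neq // idx.
Qed.

(** Remove the star of a vertex [v] of maximal degree, then that of a vertex [w] of maximal degree
    in the rest. If what remains is a matching, its edges are laid out one after another. Otherwise
    some [c] still has degree at least 2, so each removal took at least two edges, and the two
    remaining edges form a path through [c]. *)
Lemma planar_of_card_le6 (R : realType) n (E : {set {set 'I_n}}) :
  is_graph E -> (#|E| <= 6)%N -> planar R E.
Proof.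
move=> gE cardE.
have [v0 _|n0] := pickP (fun _ : 'I_n => true); last first.
  apply: (@planar_of_two_page R n (fun i => i) xpredT (fun=> 0%N) (fun=> 0%N)).
  - by move=> i; have := n0 i.
  - move=> e /gE /eqP/cards2P[a _]; by have := n0 a.
  - by move=> e e' _ _ _.
pose deg (A : {set {set 'I_n}}) x := #|edges_at A x|.
have maxdeg A : exists v, forall x, (deg A x <= deg A v)%N.
  by case: (@arg_maxnP _ v0 xpredT (deg A)) => // v _ vP; exists v => x; exact: vP.
have [v vP] := maxdeg E; pose E1 := E :\: edges_at E v.
have [w wP] := maxdeg E1; pose E2 := E1 :\: edges_at E1 w.
have sE1 : E1 \subset E by exact: finset.subsetDl.
have sE2 : E2 \subset E1 by exact: finset.subsetDl.
have coverE s : uniq s -> (forall e, e \in E2 -> consecutive s e) -> planar R E.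
  move=> s_uniq sc; apply: (@planar_of_two_stars R n E v w s) => // e eE.
  have [ve|ve] := boolP (v \in e); first exact: Or31.
  have [we|we] := boolP (w \in e); first exact: Or32.
  by apply: Or33; apply: sc; rewrite !inE eE (negPf ve) (negPf we).
have gE2 e : e \in E2 -> #|e| = 2%N.
  by move=> e2; apply: gE; exact: (fintype.subsetP (fintype.subset_trans sE2 sE1)).
have [dis|] := pselect {in E2 &, forall e e' : {set 'I_n}, e != e' -> [disjoint e & e']}.
  have [||| s [s_uniq _ sc]] := @linear_order_of_disjoint n (enum E2).
  - exact: enum_uniq.
  - by move=> e; rewrite mem_enum; exact: gE2.
  - by move=> e e'; rewrite !mem_enum; exact: dis.
  by apply: (coverE s) => // e eE2; apply: sc; rewrite mem_enum.
move=> /existsNP[e1 /existsNP[e2 /not_implyP[e1E /not_implyP[e2E]]]].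
move=> /not_implyP[e12 /negP].
rewrite -setI_eq0 => /set0Pn[c]; rewrite inE => /andP[ce1 ce2].
have other (e : {set 'I_n}) : e \in E2 -> c \in e -> exists2 a, a != c & e = [set c; a].
  move=> /gE2 /eqP/cards2P[a [b [ab ->]]]; rewrite !inE => /orP[]/eqP->.
    by exists b; rewrite // eq_sym.
  by exists a; rewrite // finset.setUC.
have degS (A B : {set {set 'I_n}}) : A \subset B -> (deg A c <= deg B c)%N.
  move=> sAB; apply: subset_leq_card; apply/fintype.subsetP => e.
  by rewrite !inE => /andP[/(fintype.subsetP sAB)-> ->].
have sub12 : [set e1; e2] \subset E2.
  by apply/fintype.subsetP => e; rewrite inE => /orP[]/set1P->.
have degE2 : (2 <= deg E2 c)%N.
  suff /subset_leq_card : [set e1; e2] \subset edges_at E2 c by rewrite cards2 e12.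
  apply/fintype.subsetP => e e_12; rewrite inE (fintype.subsetP sub12) //=.
  by move: e_12; rewrite !inE => /orP[]/eqP->.
have cardD (A : {set {set 'I_n}}) x : #|A :\: edges_at A x| = (#|A| - deg A x)%N.
  rewrite cardsD; congr (_ - #|pred_of_set _|)%N; apply/finset.setIidPr/fintype.subsetP => e.
  by rewrite inE => /andP[].
have cardE2 : (#|E2| <= 2)%N.
  rewrite cardD cardD.
  have := vP c; have := wP c; have := degS _ _ sE1; have := degS _ _ sE2.
  rewrite -/(deg _ _); lia.
have defE2 : E2 = [set e1; e2] by apply/esym/eqP; rewrite eqEcard sub12 cards2 e12.
have [a ac e1a] := other e1 e1E ce1; have [b bc e2b] := other e2 e2E ce2.
have ab : a != b by apply: contraNneq e12 => ab; rewrite e1a e2b ab.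
apply: (coverE [:: a; c; b]).
  by rewrite /= !inE negb_or ac ab (eq_sym c) bc.
move=> e; rewrite defE2 !inE => /orP[]/eqP->.
  exists a, c; split; rewrite ?inE ?eqxx ?orbT //.
    by rewrite finset.setUC.
  by rewrite /= eqxx (negPf ac) eqxx.
exists c, b; split; rewrite ?inE ?eqxx ?orbT //.
by rewrite /= (negPf ac) (negPf ab) (eq_sym c) (negPf bc) !eqxx.
Qed.

(** * Polynomials at generic configurations *)

Section GenericPolynomials.
Variables (R : realType) (n d : nat).
Notation conf := ('I_n -> 'rV[R]_d).

(** Polynomial functions over the rationals, presented by closure rules so that determinants can be
    treated without writing out coefficients. *)
Inductive polyfun : (conf -> R) -> Prop :=
| polyfun_cst (c : rat) : polyfun (fun=> ratr c)
| polyfun_coord i j : polyfun (fun p => p i 0 j)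
| polyfun_add F G : polyfun F -> polyfun G -> polyfun (fun p => F p + G p)
| polyfun_mul F G : polyfun F -> polyfun G -> polyfun (fun p => F p * G p).

Let monomial N (x : 'I_N -> R) (t : rat * {ffun 'I_N -> nat}) : R :=
  ratr t.1 * \prod_i x i ^+ t.2 i.

Lemma polyfun_monomials F : polyfun F -> exists s, forall p,
  F p = \sum_(t <- s) monomial (fun k => mxvec (conf_mx p) 0 k) t.
Proof.
elim=> {F} [c|i j|F G _ [sF FE] _ [sG GE]|F G _ [sF FE] _ [sG GE]].
- exists [:: (c, [ffun=> 0%N])] => p; rewrite big_seq1 /monomial /=.
  by rewrite big1 ?mulr1 // => k _; rewrite ffunE.
- exists [:: (1, [ffun k => (k == mxvec_index i j) : nat])] => p.
  rewrite big_seq1 /monomial /= rmorph1 mul1r (bigD1 (mxvec_index i j)) //=.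
  rewrite ffunE eqxx mxvecE mxE big1 ?mulr1 // => k /negPf kij.
  by rewrite ffunE kij.
- by exists (sF ++ sG) => p; rewrite big_cat FE GE.
- pose mulm (t u : rat * {ffun 'I_(n * d) -> nat}) :=
    (t.1 * u.1, [ffun k => (t.2 k + u.2 k)%N] : {ffun 'I_(n * d) -> nat}).
  exists [seq mulm t u | t <- sF, u <- sG] => p.
  rewrite FE GE big_allpairs_dep big_distrl; apply: eq_bigr => t _.
  rewrite big_distrr; apply: eq_bigr => u _; rewrite /monomial /= rmorphM /=.
  rewrite mulrACA -big_split; congr (_ * _); apply: eq_bigr => k _.
  by rewrite ffunE exprD.
Qed.

Lemma monomials_rpoly N (s : seq (rat * {ffun 'I_N -> nat})) :
  exists k, exists c : {ffun 'I_N -> 'I_k} -> rat, forall x : 'I_N -> R,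
    \sum_(t <- s) monomial x t = rpoly_eval c x.
Proof.
(* A common bound on all exponents; it makes the [inord] below faithful, in ['I_k.+1]. Repeated
   monomials are merged by adding their coefficients. *)
have [k sk] : exists k, forall t, t \in s -> forall i, (t.2 i <= k)%N.
  exists (\max_(t <- s) \max_i t.2 i)%N => t ts i.
  exact: leq_trans (leq_bigmax i) (leq_bigmax_seq _ ts isT).
pose c (m : {ffun 'I_N -> 'I_k.+1}) : rat :=
  \sum_(t <- s | [ffun i => inord (t.2 i)] == m) t.1.
exists k.+1, c => x; rewrite /rpoly_eval /c.
under [RHS]eq_bigr => m _ do rewrite rmorph_sum /= mulr_suml big_mkcond /=.
rewrite exchange_big /=; apply: eq_big_seq => t ts.
rewrite (bigD1 [ffun i => inord (t.2 i)]) //= eqxx [X in _ + X]big1 ?addr0 => [|m].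
  rewrite /monomial /=; congr (_ * _); apply: eq_bigr => i _.
  by rewrite ffunE inordK // ltnS sk.
by rewrite eq_sym => /negPf ->.
Qed.

(** A rational polynomial that is nonzero at one configuration has a nonzero coefficient.
    Nonvanishing at a generic [p] is thus reduced to exhibiting one convenient [q]. *)
Lemma generic_neq0 (F : conf -> R) (p q : conf) :
  polyfun F -> generic p -> F q != 0 -> F p != 0.
Proof.
move=> /polyfun_monomials[s sE] gp; have [k [c cE]] := monomials_rpoly s.
rewrite !sE !cE => Fq; apply: gp; apply: contrapT => c0.
case/eqP: Fq; rewrite /rpoly_eval big1 // => m _.
have [->|cm] := eqVneq (c m) 0; first by rewrite rmorph0 mul0r.
by case: c0; exists m.
Qed.

Lemma polyfun_sub F G : polyfun F -> polyfun G -> polyfun (fun p => F p - G p).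
Proof.
move=> pF pG; have := polyfun_add pF (polyfun_mul (polyfun_cst (-1)) pG).
by congr polyfun; apply/funext => p; rewrite rmorphN1 mulN1r.
Qed.

Lemma polyfun_sum (I : Type) (r : seq I) (F : I -> conf -> R) :
  (forall i, polyfun (F i)) -> polyfun (fun p => \sum_(i <- r) F i p).
Proof.
move=> pF; elim: r => [|i r IHr].
  have := polyfun_cst 0; congr polyfun; apply/funext => p.
  by rewrite big_nil rmorph0.
have := polyfun_add (pF i) IHr; congr polyfun; apply/funext => p.
by rewrite big_cons.
Qed.

Lemma polyfun_prod (I : Type) (r : seq I) (F : I -> conf -> R) :
  (forall i, polyfun (F i)) -> polyfun (fun p => \prod_(i <- r) F i p).
Proof.
move=> pF; elim: r => [|i r IHr].
  have := polyfun_cst 1; congr polyfun; apply/funext => p.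
  by rewrite big_nil rmorph1.
have := polyfun_mul (pF i) IHr; congr polyfun; apply/funext => p.
by rewrite big_cons.
Qed.

Lemma polyfun_det m (A : conf -> 'M[R]_m) :
  (forall i j, polyfun (fun p => A p i j)) -> polyfun (fun p => \det (A p)).
Proof.
move=> pA; apply: polyfun_sum => s; apply: polyfun_mul; last exact: polyfun_prod.
have := polyfun_cst ((-1) ^+ perm.odd_perm s); congr polyfun; apply/funext => p.
by rewrite rmorphXn rmorphN1.
Qed.

Lemma polyfun_diff i j k : polyfun (fun p => (p i - p j) 0 k).
Proof.
have := polyfun_sub (polyfun_coord i k) (polyfun_coord j k).
by congr polyfun; apply/funext => p; rewrite !mxE.
Qed.

Lemma generic_not_parallel (p : conf) (c0 c1 : 'I_d) (i j k l : 'I_n) :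
  generic p -> c0 != c1 -> i != j -> k != l -> [set i; j] != [set k; l] ->
  (p i - p j) 0 c0 * (p k - p l) 0 c1 - (p i - p j) 0 c1 * (p k - p l) 0 c0 != 0.
Proof.
move=> gp c01 ij kl neq.
(* Distinct edges: some end of the second lies outside the first, and swapping [k] and [l] only
   changes the sign. *)
wlog kij : k l kl neq / k \notin [set i; j].
  move=> wl; have [kij|] := boolP (k \in [set i; j]); last exact: wl.
  have [lij|lij] := boolP (l \in [set i; j]).
    case/eqP: neq; apply/eqP; rewrite eq_sym eqEcard !cards2 ij kl andbT.
    by apply/fintype.subsetP => x; rewrite !inE => /orP[]/eqP->; move: kij lij; rewrite !inE.
  have := wl l k; rewrite eq_sym kl [[set l; k]]finset.setUC => /(_ isT neq lij).
  apply: contraNN => /eqP e0; apply/eqP.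
  rewrite -(opprB (p k)) !mxE; rewrite !mxE in e0; lra.
(* Only [i] moves along [c0] and only [k] along [c1], which gives the determinant the value 1. *)
pose q (x : 'I_n) : 'rV[R]_d :=
  (x == i)%:R *: delta_mx 0 c0 + (x == k)%:R *: delta_mx 0 c1.
pose F (p : conf) :=
  (p i - p j) 0 c0 * (p k - p l) 0 c1 - (p i - p j) 0 c1 * (p k - p l) 0 c0.
apply: (@generic_neq0 F p q) => //.
  by apply: polyfun_sub; apply: polyfun_mul; exact: polyfun_diff.
move: kij; rewrite !inE negb_or => /andP[ki kj].
rewrite /F /q !mxE !eqxx (eq_sym j) (eq_sym j) (eq_sym i k) (negPf ij) (negPf ki).
rewrite (negPf kj) (eq_sym l k) (negPf kl) (eq_sym c1 c0) (negPf c01) /=.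
case: (l == i); rewrite /= ?mulr1n ?mulr0n; apply/eqP; lra.
Qed.

End GenericPolynomials.

(** * Balanced cuts *)

Section BalancedCut.
Variable n : nat.
Implicit Types (e : {set 'I_n}) (S : {set 'I_n}) (F : {set {set 'I_n}}).

(** The Walsh function of [e]: for an edge it is -1 exactly when [S] separates the two ends. *)
Definition cut_sign e S : int := \prod_(x in e) (-1) ^+ (x \in S).

Definition is_cut e S : bool := cut_sign e S == -1.

Lemma cut_sign_pair (a b : 'I_n) S : a != b ->
  cut_sign [set a; b] S = (-1) ^+ ((a \in S) (+) (b \in S)).
Proof.
by move=> ab; rewrite /cut_sign big_setU1 ?inE //= big_set1 signr_addb.
Qed.

Lemma cut_sign_sqr e S : cut_sign e S * cut_sign e S = 1.
Proof.
by rewrite -big_split /= big1 // => x _; rewrite -signr_addb addbb.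
Qed.

Lemma cut_signE e S : cut_sign e S = 1 - 2 * (is_cut e S)%:R.
Proof.
have := cut_sign_sqr e S => /eqP; rewrite -expr2 sqrf_eq1.
by rewrite /is_cut; case/orP => /eqP ->.
Qed.

(** Toggling the membership in [S] of a vertex of [e] outside [e'] is an involution that reverses
    every summand. *)
Lemma cut_sign_orthogonal e e' : #|e| = 2%N -> #|e'| = 2%N -> e != e' ->
  \sum_S cut_sign e S * cut_sign e' S = 0.
Proof.
move=> e2 e'2 neq.
have [k ke ke'] : exists2 k, k \in e & k \notin e'.
  apply/fintype.subsetPn; apply: contra neq => sub.
  by rewrite eqEcard sub e2 e'2.
pose toggle S := [set x | (x \in S) (+) (x == k)].
have toggleK : involutive toggle.
  by move=> S; apply/setP => x; rewrite !inE -addbA addbb addbF.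
set T := LHS; suff : T = - T by move: T => {}T; lia.
rewrite {1}/T (reindex_inj (inv_inj toggleK)) /= -sumrN; apply: eq_bigr => S _.
rewrite -mulNr; congr (_ * _).
  rewrite /cut_sign (bigD1 k) //= [in RHS](bigD1 k) //= -mulNr; congr (_ * _).
    by rewrite inE eqxx addbT; case: (k \in S).
  by apply: eq_bigr => x /andP[_ /negPf xk]; rewrite inE xk addbF.
apply: eq_bigr => x xe'; rewrite inE; have -> : (x == k) = false.
  by apply: contraNF ke' => /eqP <-.
by rewrite addbF.
Qed.

(* Second moment method: distinct edges have uncorrelated cut signs, so the
   mean over S of the squared sum of seven signs is 7, and some (odd) sum of
   signs is 1 or -1. *)
Lemma balanced_cut F : is_graph F -> #|F| = 7%N -> exists S,
  (3 <= #|[set e in F | is_cut e S]|)%N /\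
  (3 <= #|[set e in F | ~~ is_cut e S]|)%N.
Proof.
move=> gF cF; apply: contrapT => noS.
pose sigma S : int := \sum_(e in F) cut_sign e S.
(* Without a balanced cut, the number [C] of cut edges is at most 2 or at least 5, so [7 - 2 * C]
   has absolute value at least 3. *)
have sigma_ge S : 9 <= sigma S ^+ 2.
  pose C := #|[set e in F | is_cut e S]|.
  have cC : (C + #|[set e in F | ~~ is_cut e S]| = 7)%N.
    rewrite -cF -(cardsID [set e | is_cut e S] F).
    by congr (_ + _)%N; apply: eq_card => e; rewrite !inE // andbC.
  have sigmaE : sigma S = 7 - 2 * C%:R.
    rewrite /sigma; under eq_bigr => e _ do rewrite cut_signE.
    rewrite big_split /= sumr_const cF sumrN -mulr_sumr -natr_sum; congr (_ - 2 * _%:R).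
    rewrite /C -sum1_card big_mkcond [RHS]big_mkcond /=.
    by apply: eq_bigr => e _; rewrite !inE; case: (e \in F); case: (is_cut _ _).
  have {}noS : ~ ((3 <= C)%N /\ (3 <= #|[set e in F | ~~ is_cut e S]|)%N).
    by move=> h; apply: noS; exists S.
  rewrite sigmaE natz; move: cC noS; move: #|_| => D; nia.
have sum_sqr : \sum_S sigma S ^+ 2 = 7 * \sum_(S : {set 'I_n}) 1.
  under eq_bigr => S _ do rewrite expr2 /sigma mulr_suml.
  rewrite exchange_big /= [7 * _](_ : _ = \sum_(e in F) \sum_(S : {set 'I_n}) 1);
    last by rewrite [RHS]sumr_const cF mulr_natl.
  apply: eq_bigr => e eF; under eq_bigr => S _ do rewrite mulr_sumr.
  rewrite exchange_big /= (bigD1 e) //= [X in _ + X]big1 ?addr0.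
    by apply: eq_bigr => S _; exact: cut_sign_sqr.
  by move=> e' /andP[e'F]; rewrite eq_sym => ee'; apply: cut_sign_orthogonal; rewrite ?gF.
have : \sum_(S : {set 'I_n}) (9 : int) <= \sum_S sigma S ^+ 2 by apply: ler_sum.
have -> : \sum_(S : {set 'I_n}) (9 : int) = 9 * \sum_(S : {set 'I_n}) 1.
  by rewrite mulr_sumr; apply: eq_bigr => S _; rewrite mulr1.
have : 0 < \sum_(S : {set 'I_n}) (1 : int).
  by rewrite sumr_const natz ltz_nat -cardsT; apply/card_gt0P; exists finset.set0; rewrite inE.
rewrite sum_sqr; move: (\sum_(S : {set 'I_n}) (1 : int)) => N; lia.
Qed.

End BalancedCut.

(** * Edge directions on a conic *)

(** A nonzero binary quadratic form vanishes on at most two directions. *)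
Lemma binary_form_eq0 (R : realType) (a b c x1 y1 x2 y2 x3 y3 : R) :
  let form x y := a * x ^+ 2 + b * x * y + c * y ^+ 2 in
  x1 * y2 - y1 * x2 != 0 -> x1 * y3 - y1 * x3 != 0 -> x2 * y3 - y2 * x3 != 0 ->
  form x1 y1 = 0 -> form x2 y2 = 0 -> form x3 y3 = 0 ->
  [/\ a = 0, b = 0 & c = 0].
Proof.
move=> form d12 d13 d23 f1 f2 f3.
(* twice the polar form of [form] at the first two vectors *)
pose B := 2 * a * x1 * x2 + b * (x1 * y2 + x2 * y1) + 2 * c * y1 * y2.
have B0 : B = 0.
  have : (x2 * y3 - y2 * x3) * (x1 * y3 - y1 * x3) * B = 0.
    (* Expansion of the form at the third vector, written by Cramer's rule in terms of the first
       two. *)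
    transitivity ((x2 * y3 - y2 * x3) ^+ 2 * form x1 y1 +
                  (x1 * y3 - y1 * x3) ^+ 2 * form x2 y2 -
                  (x1 * y2 - y1 * x2) ^+ 2 * form x3 y3).
      by rewrite /form /B; ring.
    by rewrite f1 f2 f3 !mulr0 subr0 addr0.
  by move=> /eqP; rewrite !mulf_eq0 (negPf d13) (negPf d23) => /eqP.
have cancel z : (x1 * y2 - y1 * x2) ^+ 2 * z = 0 -> z = 0.
  by move=> /eqP; rewrite mulf_eq0 expf_eq0 (negPf d12) andbF => /eqP.
(* The coordinate vectors, scaled by the determinant, are combinations of the first two vectors; the
   form and its polar form at those vectors yield each coefficient. *)
split; apply: cancel.
- transitivity (y2 ^+ 2 * form x1 y1 + y1 ^+ 2 * form x2 y2 - y1 * y2 * B).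
    by rewrite /form /B; ring.
  by rewrite f1 f2 B0 !mulr0 subr0 addr0.
- transitivity (- 2 * x2 * y2 * form x1 y1 - 2 * x1 * y1 * form x2 y2 +
                (x1 * y2 + x2 * y1) * B).
    by rewrite /form /B; ring.
  by rewrite f1 f2 B0 !mulr0 subr0 addr0.
- transitivity (x2 ^+ 2 * form x1 y1 + x1 ^+ 2 * form x2 y2 - x1 * x2 * B).
    by rewrite /form /B; ring.
  by rewrite f1 f2 B0 !mulr0 subr0 addr0.
Qed.

Lemma mulmx_quadE (R : realType) d (w : 'rV[R]_d) (Q : 'M[R]_d) :
  (w *m Q *m w^T) 0 0 = \sum_l \sum_k w 0 k * Q k l * w 0 l.
Proof.
rewrite mxE; apply: eq_bigr => l _.
by rewrite !mxE mulr_suml.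
Qed.

Lemma big_ord2 (R : realType) (F : 'I_2 -> R) : \sum_i F i = F 0 + F 1.
Proof.
by rewrite !big_ord_recl big_ord0 addr0; congr (_ + F _); apply/val_inj.
Qed.

Lemma big_ord3 (R : realType) (F : 'I_3 -> R) : \sum_i F i = F 0 + F 1 + F ord_max.
Proof.
rewrite !big_ord_recl big_ord0 addr0 addrA.
by congr (_ + F _ + F _); apply/val_inj.
Qed.

Lemma ord2P (i : 'I_2) : i = 0 \/ i = 1.
Proof. by case: i => -[|[|//]] h; [left|right]; exact/val_inj. Qed.

Lemma ord3P (i : 'I_3) : [\/ i = 0, i = 1 | i = ord_max].
Proof.
by case: i => -[|[|[|//]]] h; [apply: Or31|apply: Or32|apply: Or33]; exact/val_inj.
Qed.

Lemma edge_ends n (E : {set {set 'I_n}}) e : is_graph E -> e \in E ->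
  exists i j, i != j /\ e = [set i; j].
Proof. by move=> gE /gE /eqP/cards2P[i [j [ij ->]]]; exists i, j. Qed.

Lemma no_conic_plane (R : realType) n (E : {set {set 'I_n}})
    (p : 'I_n -> 'rV[R]_2) (Q : 'M[R]_2) :
  generic p -> is_graph E -> (3 <= #|E|)%N -> Q^T = Q ->
  (forall i j, [set i; j] \in E ->
     ((p i - p j) *m Q *m (p i - p j)^T) 0 0 = 0) -> Q = 0.
Proof.
move=> gp gE cE Qsym conic.
have /card_gt2P[e1 [e2 [e3 [[e1E e2E e3E] [e12 e23 e31]]]]] := cE.
have [i1 [j1 [ij1 d1]]] := edge_ends gE e1E.
have [i2 [j2 [ij2 d2]]] := edge_ends gE e2E.
have [i3 [j3 [ij3 d3]]] := edge_ends gE e3E.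
rewrite {}d1 {}d2 {}d3 in e1E e2E e3E e12 e23 e31.
have Q10 : Q 1 0 = Q 0 1 by rewrite -{1}Qsym mxE.
have form i j : [set i; j] \in E ->
    Q 0 0 * (p i - p j) 0 0 ^+ 2 + (2 * Q 0 1) * (p i - p j) 0 0 * (p i - p j) 0 1
    + Q 1 1 * (p i - p j) 0 1 ^+ 2 = 0.
  move=> /conic; rewrite mulmx_quadE !big_ord2 Q10 => <-; ring.
have par := @generic_not_parallel R n 2 p 0 1.
have [|||a0 b0 c0] := binary_form_eq0 _ _ _ (form _ _ e1E) (form _ _ e2E) (form _ _ e3E).
- exact: par.
- by apply: par; rewrite // eq_sym.
- exact: par.
have b0' : Q 0 1 = 0 by lra.
apply/matrixP => i j; rewrite mxE.
by case: (ord2P i) => ->; case: (ord2P j) => ->; rewrite ?Q10.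
Qed.

(** * Quadratic forms on edge directions in space *)

Section Space.
Variables (R : realType) (n : nat).
Notation conf := ('I_n -> 'rV[R]_3).

(** The three edge directions, projected to coordinates [c0] and [c1], are not collinear: [D] is
    twice the signed area of their triangle. The last disjunction says that the third edge has an
    end shared with neither of the others. *)
Lemma generic_affinely_independent d (p : 'I_n -> 'rV[R]_d) (c0 c1 : 'I_d)
    (s1 t1 s2 t2 s3 t3 : 'I_n) (S : {set 'I_n}) :
  generic p -> c0 != c1 ->
  [/\ s1 \in S, s2 \in S & s3 \in S] ->
  [/\ t1 \notin S, t2 \notin S & t3 \notin S] ->
  (s1 != s2) || (t1 != t2) -> (s1 != s3) && (s2 != s3) || (t1 != t3) && (t2 != t3) ->
  forall a b c : R,
  a + b * (p s1 - p t1) 0 c0 + c * (p s1 - p t1) 0 c1 = 0 ->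
  a + b * (p s2 - p t2) 0 c0 + c * (p s2 - p t2) 0 c1 = 0 ->
  a + b * (p s3 - p t3) 0 c0 + c * (p s3 - p t3) 0 c1 = 0 ->
  [/\ a = 0, b = 0 & c = 0].
Proof.
move=> gp c01 [s1S s2S s3S] [t1S t2S t3S] neq12 leaf a b c.
pose D (p : 'I_n -> 'rV[R]_d) :=
  ((p s2 - p t2) 0 c0 - (p s1 - p t1) 0 c0) * ((p s3 - p t3) 0 c1 - (p s1 - p t1) 0 c1) -
  ((p s2 - p t2) 0 c1 - (p s1 - p t1) 0 c1) * ((p s3 - p t3) 0 c0 - (p s1 - p t1) 0 c0).
have : D p != 0.
  have pD : polyfun D.
    by apply: polyfun_sub; apply: polyfun_mul; apply: polyfun_sub; exact: polyfun_diff.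
  have st x y : x \in S -> y \notin S -> (x == y) = false.
    by move=> xS yS; apply: contraNF yS => /eqP <-.
  have ts x y : x \in S -> y \notin S -> (y == x) = false.
    by move=> xS yS; rewrite eq_sym st.
  have TS := (ts _ _ s2S t1S, ts _ _ s2S t2S, ts _ _ s2S t3S,
              ts _ _ s3S t1S, ts _ _ s3S t2S, ts _ _ s3S t3S).
  have ST := (st _ _ s1S t2S, st _ _ s2S t2S, st _ _ s3S t2S,
              st _ _ s1S t3S, st _ _ s2S t3S, st _ _ s3S t3S).
  (* With [k] an end of the second edge off the first, and [w] a free end of the third, the first
     direction projects to the origin, the second and third to independent vectors, and [D] is 1 or
     -1. *)
  pose q (k w x : 'I_n) : 'rV[R]_d :=
    (x == k)%:R *: delta_mx 0 c0 + (x == w)%:R *: delta_mx 0 c1.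
  have qE0 k w x y : (q k w x - q k w y) 0 c0 = (x == k)%:R - (y == k)%:R.
    by rewrite !mxE !eqxx (negPf c01) /= !mulr1 !mulr0 !addr0.
  have qE1 k w x y : (q k w x - q k w y) 0 c1 = (x == w)%:R - (y == w)%:R.
    by rewrite !mxE !eqxx (eq_sym c1) (negPf c01) /= !mulr1 !mulr0 !add0r.
  case/orP: neq12 => /negPf n12; case/orP: leaf => /andP[/negPf n13 /negPf n23].
  - apply: (generic_neq0 (q := q s2 s3) pD gp); rewrite /D !qE0 !qE1.
    rewrite ?TS ?ST ?(eq_sym s3) n12 n13 n23 !eqxx /= ?mulr1n ?mulr0n.
    apply/eqP; lra.
  - apply: (generic_neq0 (q := q s2 t3) pD gp); rewrite /D !qE0 !qE1.
    rewrite ?TS ?ST n12 n13 n23 !eqxx /= ?mulr1n ?mulr0n.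
    apply/eqP; lra.
  - apply: (generic_neq0 (q := q t2 s3) pD gp); rewrite /D !qE0 !qE1.
    rewrite ?TS ?ST n12 n13 n23 !eqxx /= ?mulr1n ?mulr0n.
    apply/eqP; lra.
  - apply: (generic_neq0 (q := q t2 t3) pD gp); rewrite /D !qE0 !qE1.
    rewrite ?TS ?ST ?(eq_sym t3) n12 n13 n23 !eqxx /= ?mulr1n ?mulr0n.
    apply/eqP; lra.
rewrite /D.
move: ((p s1 - p t1) 0 c0) ((p s1 - p t1) 0 c1) ((p s2 - p t2) 0 c0)
  ((p s2 - p t2) 0 c1) ((p s3 - p t3) 0 c0) ((p s3 - p t3) 0 c1).
move=> x1 y1 x2 y2 x3 y3; set D' := (X in X != 0) => D'0 f1 f2 f3.
have b0 : b = 0.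
  apply: (mulIf D'0); rewrite mul0r.
  transitivity ((a + b * x2 + c * y2 - (a + b * x1 + c * y1)) * (y3 - y1) -
                (a + b * x3 + c * y3 - (a + b * x1 + c * y1)) * (y2 - y1)).
    by rewrite /D'; ring.
  by rewrite f1 f2 f3 !subr0 !mul0r subr0.
have c_0 : c = 0.
  apply: (mulIf D'0); rewrite mul0r.
  transitivity ((a + b * x3 + c * y3 - (a + b * x1 + c * y1)) * (x2 - x1) -
                (a + b * x2 + c * y2 - (a + b * x1 + c * y1)) * (x3 - x1)).
    by rewrite /D'; ring.
  by rewrite f1 f2 f3 !subr0 !mul0r subr0.
by split=> //; move: f1; rewrite b0 c_0 !mul0r !addr0.
Qed.

(** Three distinct cut edges form a bipartite graph, hence a forest; some edge has a leaf, and the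
    edges are permuted so that it comes last. *)
Lemma cut_affinely_independent d (p : 'I_n -> 'rV[R]_d) (c0 c1 : 'I_d)
    (s1 t1 s2 t2 s3 t3 : 'I_n) (S : {set 'I_n}) :
  generic p -> c0 != c1 ->
  [/\ s1 \in S, s2 \in S & s3 \in S] ->
  [/\ t1 \notin S, t2 \notin S & t3 \notin S] ->
  (s1, t1) != (s2, t2) -> (s2, t2) != (s3, t3) -> (s3, t3) != (s1, t1) ->
  forall a b c : R,
  a + b * (p s1 - p t1) 0 c0 + c * (p s1 - p t1) 0 c1 = 0 ->
  a + b * (p s2 - p t2) 0 c0 + c * (p s2 - p t2) 0 c1 = 0 ->
  a + b * (p s3 - p t3) 0 c0 + c * (p s3 - p t3) 0 c1 = 0 ->
  [/\ a = 0, b = 0 & c = 0].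
Proof.
move=> gp c01 [s1S s2S s3S] [t1S t2S t3S]; rewrite !xpair_eqE !negb_and.
move=> n12 n23 n31 a b c f1 f2 f3.
have n13 : (s1 != s3) || (t1 != t3) by rewrite eq_sym (eq_sym t1).
have n32 : (s3 != s2) || (t3 != t2) by rewrite eq_sym (eq_sym t3).
have indep := generic_affinely_independent (S := S) gp c01.
have [leaf3|noleaf3] := boolP ((s1 != s3) && (s2 != s3) || (t1 != t3) && (t2 != t3)).
  exact: (indep s1 t1 s2 t2 s3 t3).
have [leaf2|noleaf2] := boolP ((s1 != s2) && (s3 != s2) || (t1 != t2) && (t3 != t2)).
  exact: (indep s1 t1 s3 t3 s2 t2).
apply: (indep s2 t2 s3 t3 s1 t1 _ _ _ _ a b c) => //.
move: n12 n23 n31 noleaf2 noleaf3.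
rewrite !(eq_sym s3) !(eq_sym t3) (eq_sym s2 s1) (eq_sym t2 t1).
have [<-|] := eqVneq s1 s2; have [<-|] := eqVneq t1 t2; rewrite //=.
- by have [<-|] := eqVneq t2 t3.
- by have [<-|] := eqVneq s2 s3; rewrite //= orbF => ->.
Qed.

(** With [quad_mono2], this lists the monomials [x^2, y^2, z^2, xy, xz, yz] as products of two
    coordinates. *)
Definition quad_mono1 (c : 'I_6) : 'I_3 := nth 0 [:: 0; 1; ord_max; 0; 0; 1] c.
Definition quad_mono2 (c : 'I_6) : 'I_3 :=
  nth 0 [:: 0; 1; ord_max; 1; ord_max; ord_max] c.

Definition ternary_form (v : 'rV[R]_6) (w : 'rV[R]_3) : R :=
  \sum_c v 0 c * (w 0 (quad_mono1 c) * w 0 (quad_mono2 c)).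

Definition tform (v : nat -> R) (w : 'rV[R]_3) : R :=
  let x := w 0 0 in let y := w 0 1 in let z := w 0 ord_max in
  v 0%N * x ^+ 2 + v 1%N * y ^+ 2 + v 2%N * z ^+ 2 +
  v 3%N * x * y + v 4%N * x * z + v 5%N * y * z.

Lemma ternary_formE v w : ternary_form v w = tform (fun k => v 0 (inord k)) w.
Proof.
have sum6 (F : 'I_6 -> R) : \sum_c F c =
    F (inord 0) + F (inord 1) + F (inord 2) + F (inord 3) + F (inord 4) + F (inord 5).
  rewrite !big_ord_recl big_ord0 addr0 !addrA.
  by congr (F _ + F _ + F _ + F _ + F _ + F _); apply/val_inj; rewrite /= inordK.
by rewrite /ternary_form sum6 /quad_mono1 /quad_mono2 /tform !inordK //=; ring.
Qed.

(* A nonzero ternary form vanishing on six edge directions exists iff a 6 x 6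
   determinant, polynomial in the configuration, vanishes. *)
Lemma generic_ternary_form (s t : 'I_6 -> 'I_n) (p q : conf) :
  generic p ->
  (exists2 v, v != 0 & forall e, ternary_form v (p (s e) - p (t e)) = 0) ->
  exists2 v, v != 0 & forall e, ternary_form v (q (s e) - q (t e)) = 0.
Proof.
(* Column [e] holds the six monomials at the direction of edge [e], so a left kernel vector is a
   form vanishing on all six edges. *)
pose A (r : conf) : 'M[R]_6 := \matrix_(c, e)
  ((r (s e) - r (t e)) 0 (quad_mono1 c) * (r (s e) - r (t e)) 0 (quad_mono2 c)).
have AE r v e : (v *m A r) 0 e = ternary_form v (r (s e) - r (t e)).
  by rewrite mxE; apply: eq_bigr => c _; rewrite [A r c e]mxE.
have pA : polyfun (fun r => \det (A r)).
  apply: polyfun_det => c e.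
  have := polyfun_mul (polyfun_diff R (s e) (t e) (quad_mono1 c))
                      (polyfun_diff R (s e) (t e) (quad_mono2 c)).
  by congr polyfun; apply/funext => r; rewrite [A r c e]mxE.
move=> gp [v v0 vp].
have detp : \det (A p) == 0.
  by apply/det0P; exists v => //; apply/rowP => e; rewrite AE vp mxE.
have detq : \det (A q) == 0 by apply: contraTT detp; exact: (generic_neq0 pA gp).
have /det0P[u u0 uA] := detq.
by exists u => // e; rewrite -AE uA mxE.
Qed.

End Space.

Lemma cut_ends n (E : {set {set 'I_n}}) e S : is_graph E -> e \in E ->
  is_cut e S -> exists i j, [/\ i \in S, j \notin S & e = [set i; j]].
Proof.
move=> gE eE; have [i [j [ij ->]]] := edge_ends gE eE.
rewrite /is_cut cut_sign_pair //.
have [iS|iS] := boolP (i \in S); have [jS|jS] := boolP (j \in S) => //= _.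
  by exists i, j.
by exists j, i; rewrite finset.setUC.
Qed.

Lemma noncut_ends n (E : {set {set 'I_n}}) e S : is_graph E -> e \in E ->
  ~~ is_cut e S ->
  exists i j, [/\ i != j, (i \in S) = (j \in S) & e = [set i; j]].
Proof.
move=> gE eE; have [i [j [ij ->]]] := edge_ends gE eE.
rewrite /is_cut cut_sign_pair // => cut; exists i, j; split => //.
by move: cut; case: (i \in S); case: (j \in S).
Qed.

(* The configuration is specialised to one whose last coordinate is the
   indicator of one side of a balanced cut: uncut edges become horizontal and
   kill the restriction of the form to the horizontal plane, after which the
   cut edges give linear equations on the remaining coefficients. *)
Lemma no_conic_space (R : realType) n (E : {set {set 'I_n}})
    (p : 'I_n -> 'rV[R]_3) (Q : 'M[R]_3) :
  generic p -> is_graph E -> (7 <= #|E|)%N -> Q^T = Q ->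
  (forall i j, [set i; j] \in E ->
     ((p i - p j) *m Q *m (p i - p j)^T) 0 0 = 0) -> Q = 0.
Proof.
move=> gp gE cE Qsym conic.
have [F [sFE cF]] : exists F : {set {set 'I_n}}, F \subset E /\ #|F| = 7%N.
  have [s [s_uniq ss sE]] : exists s : seq {set 'I_n},
      [/\ uniq s, size s = 7%N & {subset s <= E}].
    exists (take 7 (enum E)); split.
    - by rewrite take_uniq ?enum_uniq.
    - by rewrite size_takel // -cardE.
    - by move=> e /mem_take; rewrite mem_enum.
  exists [set e in s]; split; first by apply/fintype.subsetP => e; rewrite inE => /sE.
  by rewrite cardsE (card_uniqP s_uniq).
have gF : is_graph F by move=> e eF; apply: gE; exact: (fintype.subsetP sFE).
have [S [cut3 noncut3]] := balanced_cut gF cF.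
have FE e : e \in F -> e \in E by exact: (fintype.subsetP sFE).
have /card_gt2P[e1 [e2 [e3 [[]]]]] := cut3; rewrite !inE.
move=> /andP[e1F c1] /andP[e2F c2] /andP[e3F c3] [n12 n23 n31].
have /card_gt2P[f1 [f2 [f3 [[]]]]] := noncut3; rewrite !inE.
move=> /andP[f1F d1] /andP[f2F d2] /andP[f3F d3] [m12 m23 m31].
have [s1 [t1 [s1S t1S E1]]] := cut_ends gF e1F c1.
have [s2 [t2 [s2S t2S E2]]] := cut_ends gF e2F c2.
have [s3 [t3 [s3S t3S E3]]] := cut_ends gF e3F c3.
have [u1 [w1 [uw1 uS1 F1]]] := noncut_ends gF f1F d1.
have [u2 [w2 [uw2 uS2 F2]]] := noncut_ends gF f2F d2.
have [u3 [w3 [uw3 uS3 F3]]] := noncut_ends gF f3F d3.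
rewrite {}E1 {}E2 {}E3 in e1F e2F e3F n12 n23 n31 c1 c2 c3.
rewrite {}F1 {}F2 {}F3 in f1F f2F f3F m12 m23 m31 d1 d2 d3.
have Q10 : Q 1 0 = Q 0 1 by rewrite -{1}Qsym mxE.
have Q20 : Q ord_max 0 = Q 0 ord_max by rewrite -{1}Qsym mxE.
have Q21 : Q ord_max 1 = Q 1 ord_max by rewrite -{1}Qsym mxE.
pose V k : R := nth 0 [:: Q 0 0; Q 1 1; Q ord_max ord_max;
  2 * Q 0 1; 2 * Q 0 ord_max; 2 * Q 1 ord_max] k.
pose v : 'rV[R]_6 := \row_c V c.
have vE k : (k < 6)%N -> v 0 (inord k) = V k by move=> k6; rewrite mxE inordK.
have formp i j : [set i; j] \in F -> ternary_form v (p i - p j) = 0.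
  move=> /FE /conic; rewrite mulmx_quadE !big_ord3 Q10 Q20 Q21 => <-.
  rewrite ternary_formE /tform !vE // /V /=; ring.
suff v0 : v = 0.
  have V0 k : (k < 6)%N -> V k = 0 by move=> k6; rewrite -vE // v0 mxE.
  have := V0 0%N isT; have := V0 1%N isT; have := V0 2%N isT.
  have := V0 3%N isT; have := V0 4%N isT; have := V0 5%N isT; rewrite /V /=.
  have half (x : R) : 2 * x = 0 -> x = 0.
    by move=> /eqP; rewrite mulf_eq0 pnatr_eq0 => /eqP.
  move=> /half q12 /half q02 /half q01 q22 q11 q00; apply/matrixP => i j; rewrite mxE.
  by case: (ord3P i) => ->; case: (ord3P j) => ->; rewrite ?Q10 ?Q20 ?Q21.
apply/eqP; apply: contraT => v0.
pose s (e : 'I_6) := nth s1 [:: s1; s2; s3; u1; u2; u3] e.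
pose t (e : 'I_6) := nth s1 [:: t1; t2; t3; w1; w2; w3] e.
(* The first two coordinates remain those of the generic [p], so planar genericity still applies to
   them. *)
pose q (i : 'I_n) : 'rV[R]_3 :=
  \row_k (if k == ord_max then (i \in S)%:R else p i 0 k).
have [|u u0 uq] := @generic_ternary_form R n s t p q gp.
  exists v => // e; rewrite /s /t; apply: formp.
  by case: e => -[|[|[|[|[|[|//]]]]]] /=.
have qx i j : (q i - q j) 0 0 = (p i - p j) 0 0 by rewrite !mxE.
have qy i j : (q i - q j) 0 1 = (p i - p j) 0 1 by rewrite !mxE.
have qz i j : (q i - q j) 0 ord_max = (i \in S)%:R - (j \in S)%:R by rewrite !mxE.
have form6 k (k6 : (k < 6)%N) := uq (Ordinal k6).
pose U k := u 0 (inord k).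
have uncut i j : (i \in S) = (j \in S) -> ternary_form u (q i - q j) =
    U 0%N * (p i - p j) 0 0 ^+ 2 + U 3%N * (p i - p j) 0 0 * (p i - p j) 0 1
    + U 1%N * (p i - p j) 0 1 ^+ 2.
  by move=> ij; rewrite ternary_formE /tform qx qy qz ij /U; ring.
have par := @generic_not_parallel R n 3 p 0 1.
have [||||||U0 U3 U1] := @binary_form_eq0 R (U 0%N) (U 3%N) (U 1%N)
  ((p u1 - p w1) 0 0) ((p u1 - p w1) 0 1) ((p u2 - p w2) 0 0) ((p u2 - p w2) 0 1)
  ((p u3 - p w3) 0 0) ((p u3 - p w3) 0 1).
- exact: par.
- by apply: par; rewrite // eq_sym.
- exact: par.
- by rewrite -uncut //; exact: (form6 3%N isT).
- by rewrite -uncut //; exact: (form6 4%N isT).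
- by rewrite -uncut //; exact: (form6 5%N isT).
(* A cut edge has last coordinate 1; as the horizontal coefficients vanish, an affine equation
   remains. *)
have cut i j : i \in S -> j \notin S -> ternary_form u (q i - q j) =
    U 2%N + U 4%N * (p i - p j) 0 0 + U 5%N * (p i - p j) 0 1.
  move=> iS jS; rewrite ternary_formE /tform qx qy qz iS (negPf jS) /= -/(U 0%N) -/(U 1%N).
  by rewrite -/(U 2%N) -/(U 3%N) -/(U 4%N) -/(U 5%N) U0 U1 U3; ring.
have neq_pair (a b c d : 'I_n) : [set a; b] != [set c; d] -> (a, b) != (c, d).
  by apply: contraNneq => -[-> ->].
have [|||U2 U4 U5] := @cut_affinely_independent R n 3 p 0 1 s1 t1 s2 t2 s3 t3 S gp isT
  (And3 s1S s2S s3S) (And3 t1S t2S t3S) (neq_pair _ _ _ _ n12)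
  (neq_pair _ _ _ _ n23) (neq_pair _ _ _ _ n31) (U 2%N) (U 4%N) (U 5%N).
- by rewrite -cut //; exact: (form6 0%N isT).
- by rewrite -cut //; exact: (form6 1%N isT).
- by rewrite -cut //; exact: (form6 2%N isT).
case/eqP: u0; apply/rowP => c; rewrite mxE -[c]inord_val -/(U c).
by case: c => -[|[|[|[|[|[|//]]]]]].
Qed.

(** * Edge counts and conclusion *)

Lemma is_graph_plus_edge n (E : {set {set 'I_n}}) u v :
  is_graph E -> u != v -> is_graph ([set u; v] |: E).
Proof. by move=> gE uv e; rewrite !inE => /orP[/eqP->|/gE//]; rewrite cards2 uv. Qed.

(** On two vertices a Laman graph already uses the only possible edge, leaving no room for another;
    so [n] is at least 3. *)
Lemma laman_plus_edge_card n (E : {set {set 'I_n}}) u v :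
  laman E -> u != v -> [set u; v] \notin E -> (3 <= #|[set u; v] |: E|)%N.
Proof.
move=> [gE [cE _]] uv uvE.
have n3 : (3 <= n)%N.
  have n2 : (2 <= n)%N.
    by have := max_card (mem [set u; v]); rewrite cards2 uv card_ord.
  rewrite ltn_neqAle n2 andbT; apply: contraNneq uvE => n_2.
  have /set0Pn[e eE] : E != finset.set0 by rewrite -card_gt0 cE -n_2.
  suff -> : [set u; v] = e by [].
  have T2 (e' : {set 'I_n}) : #|e'| = 2%N -> e' = [set: 'I_n].
    by move=> c2; apply/eqP; rewrite eqEcard finset.subsetT cardsT card_ord c2 -n_2.
  by rewrite (T2 e (gE _ eE)) (T2 [set u; v]) // cards2 uv.
rewrite cardsU1 uvE cE; lia.
Qed.

Theorem mainTheorem14 (R : realType) (n d : nat) (E : {set {set 'I_n}})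
  (p : 'I_n -> 'rV[R]_d) :
  generic p ->
  ((d = 2%N /\ plus_one_edge (@laman n) E) \/
   (d = 3%N /\ plus_one_edge (@maximal_planar R n) E)) ->
  dim_rigid E p ->
  univ_rigid E p.
Proof.
move=> gp [[d2 [E' [u [v [lE' [uv [uvE' ->]]]]]]]|
           [d3 [E' [u [v [[gE' [_ maxE']] [uv [uvE' ->]]]]]]]].
- subst d; apply: univ_rigid_of_no_conic => Q.
  apply: no_conic_plane => //; last exact: laman_plus_edge_card.
  by apply: is_graph_plus_edge => //; case: lE'.
- subst d; apply: univ_rigid_of_no_conic => Q.
  have gE := is_graph_plus_edge gE' uv.
  apply: no_conic_space => //.
  (* With at most six edges the enlarged graph would be planar, against maximality. *)
  rewrite ltnNge; apply/negP => cE.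
  exact: maxE' uv uvE' (planar_of_card_le6 R gE cE).
Qed.
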